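(* Let $D$ be an oriented twisted knot diagram and let $D^*$ denote its mirror image. Then $$\mathcal{B}_{D^*}(t)=-\mathcal{B}_D(t).$$
   Context: Twisted diagrams. A twisted link diagram is a generic immersion of circles in the plane in which every double point is either a classical crossing (with over/under information) or a virtual crossing, together with finitely many bars (short transverse marks) placed on edges away from the crossings. A twisted knot diagram has one circle. The mirror image $D^*$ of $D$ is obtained by interchanging the over and under strands at every classical crossing of $D$ (orientation, bars and virtual crossings unchanged). Sign. $\operatorname{sgn}(c)=+1$ if the under-strand direction is obtained from the over-strand direction by a counterclockwise rotation by an angle less than $\pi$, and $-1$ otherwise. Arcs. In an oriented diagram, a component with at most one bar is regarded as a single arc; otherwise the arcs of a component are its segments between two consecutive bars. For an arc $C$, $\langle C=C_1,\dots,C_n\rangle$ denotes the sequence of all arcs of the component containing $C$, in the order met when travelling along the orientation starting from $C$. Linking sets. In a two-component oriented diagram $L$, a linking crossing is a classical crossing between different components. For an arc $C$, $\mathcal{O}(C)$ (resp. $\mathcal{U}(C)$) is the set of linking crossings met as overcrossings (resp. undercrossings) when traversing $C$. With $\langle C=C_1,\dots,C_n\rangle$ the sequence of all arcs of the component of $L$ containing $C$, in the order met when travelling along the orientation starting from $C$, $\mathcal{O}_L(L:C)=\mathcal{O}(C_1)\cup\mathcal{U}(C_2)\cup\mathcal{O}(C_3)\cup\cdots$ and $\mathcal{U}_L(L:C)=\mathcal{U}(C_1)\cup\mathcal{O}(C_2)\cup\mathcal{U}(C_3)\cup\cdots$, alternating through $C_n$. Indices. Let $c$ be a classical crossing of an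 oriented twisted knot diagram $D$. Put a base point $\alpha$ on the incoming part of the under strand and a base point $\beta$ on the incoming part of the over strand, both immediately before $c$. Smoothing $c$ along the orientation (incoming under strand joined to outgoing over strand, incoming over strand joined to outgoing under strand) gives an oriented two-component diagram $D_c$. Let $C$, $C'$ be the arcs of $D_c$ containing $\alpha$, $\beta$ respectively. Then $\operatorname{Ind}^1(c)=\sum_{x\in\mathcal{O}_L(D_c:C)}\operatorname{sgn}(x)-\sum_{x\in\mathcal{U}_L(D_c:C)}\operatorname{sgn}(x)$, and $\operatorname{Ind}^2(c)$ is the same expression with $C'$ in place of $C$. $\mathcal{B}$-Index polynomial. $\mathcal{B}_D(t)=\sum_{c\in\mathcal{C}(D)}\operatorname{sgn}(c)\left(t^{\operatorname{Ind}^1(c)+\operatorname{Ind}^2(c)}-1\right)$, where $\mathcal{C}(D)$ is the set of classical crossings of $D$. *)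

(* Defs.v *)
From HB Require Import structures.
From mathcomp Require Import all_boot all_order all_algebra.
From mathcomp Require Import finmap.
From mathcomp Require Import all_classical all_reals all_analysis.

Set Implicit Arguments.
Unset Strict Implicit.
Unset Printing Implicit Defensive.

Import Order.TTheory GRing.Theory Num.Theory.
Import numFieldNormedType.Exports.

Local Open Scope classical_set_scope.
Local Open Scope fset_scope.
Local Open Scope ring_scope.

Definition swap (T : Type) (c : T * T) : T * T := (c.2, c.1).

Definition circle_param (R : realType) (t : R) : Prop := 0 <= t < 1.

(* The circle is R/Z, oriented by increasing parameter and represented by
   [0, 1[; closed curves are 1-periodic functions on the whole of R. *)
Definition closed_smooth_immersion (R : realType) (x y : R -> R) : Prop :=
  [/\ forall t, x (t + 1) = x t /\ y (t + 1) = y t,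
      forall k t, derivable (derive1n k x) t 1 /\
                  derivable (derive1n k y) t 1
    & forall t, (derive1 x t, derive1 y t) <> (0, 0)].

Definition double_point (R : realType) (x y : R -> R) (p : R * R) : Prop :=
  [/\ circle_param p.1, circle_param p.2, p.1 <> p.2
    & (x p.1, y p.1) = (x p.2, y p.2)].

Definition generic_curve (R : realType) (x y : R -> R) : Prop :=
  [/\ finite_set [set p | double_point x y p],
      forall p, double_point x y p ->
        derive1 x p.1 * derive1 y p.2 - derive1 y p.1 * derive1 x p.2 <> 0
    & forall s t u, double_point x y (s, t) -> double_point x y (t, u) ->
        s = u].

(* A classical crossing is the pair (parameter of the over passage, parameter
   of the under passage).  The double points that occur in [classical] in
   neither order are the virtual crossings. *)
Record twisted_knot_diagram (R : realType) := TwistedKnotDiagram {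
  xcoord : R -> R;
  ycoord : R -> R;
  classical : {fset R * R};
  bars : {fset R};
  immersedP : closed_smooth_immersion xcoord ycoord;
  genericP : generic_curve xcoord ycoord;
  classical_double : forall c, c \in classical -> double_point xcoord ycoord c;
  classical_asym : forall c, c \in classical -> swap c \notin classical;
  bars_circle : forall b, b \in bars -> circle_param b;
  bars_off_crossings : forall b t, b \in bars ->
    ~ double_point xcoord ycoord (b, t) }.

Definition mirror_classical (T : choiceType) (X : {fset T * T}) :
  {fset T * T} := [fset swap c | c in X].

Lemma mem_mirror_classical (T : choiceType) (X : {fset T * T}) (c : T * T) :
  (c \in mirror_classical X) = (swap c \in X).
Proof.
apply/imfsetP/idP => /= [[d dX ->]|cX]; first by case: d dX.
by exists (swap c) => //; case: c cX.
Qed.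

Lemma mirror_classical_double (R : realType) (D : twisted_knot_diagram R) c :
  c \in mirror_classical (classical D) ->
  double_point (xcoord D) (ycoord D) c.
Proof.
rewrite mem_mirror_classical => /classical_double[/= h1 h2 h3 h4].
by split=> //; exact/nesym.
Qed.

Lemma mirror_classical_asym (R : realType) (D : twisted_knot_diagram R) c :
  c \in mirror_classical (classical D) ->
  swap c \notin mirror_classical (classical D).
Proof. by rewrite !mem_mirror_classical => /classical_asym. Qed.

Definition mirror (R : realType) (D : twisted_knot_diagram R) :
    twisted_knot_diagram R :=
  @TwistedKnotDiagram R (xcoord D) (ycoord D)
    (mirror_classical (classical D)) (bars D)
    (immersedP D) (genericP D)
    (@mirror_classical_double R D) (@mirror_classical_asym R D)
    (@bars_circle R D) (@bars_off_crossings R D).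

(* The direction of [w] is that of [v] rotated counterclockwise by an angle
   strictly between 0 and pi. *)
Definition ccw_from (R : realType) (v w : R * R) : Prop :=
  exists r theta : R,
    [/\ 0 < r, 0 < theta < pi
      & w = (r * (cos theta * v.1 - sin theta * v.2),
             r * (sin theta * v.1 + cos theta * v.2))].

Definition sgn (R : realType) (dir : R -> R * R) (c : R * R) : int :=
  if `[< ccw_from (dir c.1) (dir c.2) >] then 1 else -1.

Definition tangent (R : realType) (D : twisted_knot_diagram R) (t : R) :
  R * R := (derive1 (xcoord D) t, derive1 (ycoord D) t).

(* What the linking sets of an oriented two-component diagram depend on: each
   component is the cyclic word of the bars and classical passages met along
   it, written from a base point of that component (the base point lies
   between the last and the first letter); a crossing is again a pair (over
   passage, under passage). *)
Record link_diagram (T : choiceType) := LinkDiagram {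
  component1 : seq T;
  component2 : seq T;
  link_classical : {fset T * T};
  link_bars : {fset T} }.

Definition linking (T : choiceType) (L : link_diagram T) (x : T * T) : bool :=
  (x.1 \in component1 L) && (x.2 \in component2 L)
  || (x.1 \in component2 L) && (x.2 \in component1 L).

Fixpoint split_at (T : Type) (a : pred T) (w : seq T) : seq (seq T) :=
  if w is x :: w' then
    if a x then [::] :: split_at a w'
    else (x :: head [::] (split_at a w')) :: behead (split_at a w')
  else [:: [::]].

(* The arcs C_1, ..., C_n of the component [K], where C_1 is the arc that
   contains the base point: C_1 consists of the piece of [K] after the last
   bar followed by the piece before the first bar. *)
Definition arcs (T : choiceType) (B : {fset T}) (K : seq T) : seq (seq T) :=
  if (count (mem B) K <= 1)%N then [:: K]
  else if split_at (mem B) K is s0 :: s then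
    (last [::] s ++ s0) :: take (size s).-1 s
  else [::].

Definition over_set (T : choiceType) (L : link_diagram T) (C : seq T) :
  {fset T * T} := [fset x in link_classical L | linking L x & x.1 \in C].

Definition under_set (T : choiceType) (L : link_diagram T) (C : seq T) :
  {fset T * T} := [fset x in link_classical L | linking L x & x.2 \in C].

Fixpoint alternating_union (T : choiceType) (A B : seq T -> {fset T * T})
    (s : seq (seq T)) : {fset T * T} :=
  if s is C :: s' then A C `|` alternating_union B A s' else fset0.

Definition over_linking_set (T : choiceType) (L : link_diagram T)
    (K : seq T) : {fset T * T} :=
  alternating_union (over_set L) (under_set L) (arcs (link_bars L) K).

Definition under_linking_set (T : choiceType) (L : link_diagram T)
    (K : seq T) : {fset T * T} :=
  alternating_union (under_set L) (over_set L) (arcs (link_bars L) K).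

(* The marked parameters, in the order met along the knot from parameter 0. *)
Definition marks (R : realType) (D : twisted_knot_diagram R) : seq R :=
  sort <=%R (enum_fset (bars D `|` [fset c.1 | c in classical D]
                               `|` [fset c.2 | c in classical D])).

(* Smoothing at c = (o, u) joins the incoming under strand to the outgoing
   over strand.  From alpha, immediately before u, one therefore continues
   along the knot from o until u is reached again; from beta, immediately
   before o, one continues from u until o is reached again.  Hence the two
   words below start at alpha and at beta respectively.  All other crossings
   keep their tangent directions, hence their signs. *)
Definition smoothing (R : realType) (D : twisted_knot_diagram R)
    (c : R * R) : link_diagram R :=
  {| component1 := behead (arc (marks D) c.1 c.2);
     component2 := behead (arc (marks D) c.2 c.1);
     link_classical := classical D `\ c;
     link_bars := bars D |}.

Definition linking_difference (R : realType) (dir : R -> R * R)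
    (L : link_diagram R) (K : seq R) : int :=
  \sum_(x <- over_linking_set L K) sgn dir x
  - \sum_(x <- under_linking_set L K) sgn dir x.

Definition ind1 (R : realType) (D : twisted_knot_diagram R) (c : R * R) :
    int :=
  linking_difference (tangent D) (smoothing D c) (component1 (smoothing D c)).

Definition ind2 (R : realType) (D : twisted_knot_diagram R) (c : R * R) :
    int :=
  linking_difference (tangent D) (smoothing D c) (component2 (smoothing D c)).

(* Laurent polynomials in t are taken inside the field of fractions of
   Z[t]. *)
Definition laurent_t : {fraction {poly int}} := tofrac 'X.

Definition B_index_polynomial (R : realType) (D : twisted_knot_diagram R) :
    {fraction {poly int}} :=
  \sum_(c <- classical D)
    (sgn (tangent D) c)%:~R * (laurent_t ^ (ind1 D c + ind2 D c) - 1).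

(* Main.v *)
Require Import Defs.
From mathcomp Require Import all_boot all_order all_algebra.
From mathcomp Require Import finmap.
From mathcomp Require Import ring.
From mathcomp Require Import all_classical all_reals all_analysis.

(** Mirroring replaces each classical crossing c = (o, u) by (u, o).  The
    two components of the smoothing at c then trade places, so Ind^1 and
    Ind^2 are exchanged; inside each index the sets O and U are exchanged
    and every sign changes, which leaves the value unchanged.  Only the
    outer factor sgn(c) contributes a sign.  That a sign does change is the
    transversality of double points: ccw_from v w means that v and w have
    positive determinant. *)

Set Implicit Arguments.
Unset Strict Implicit.
Unset Printing Implicit Defensive.

Import Order.TTheory GRing.Theory Num.Theory.

Local Open Scope fset_scope.
Local Open Scope ring_scope.

(** A rotation by [t] with scaling [r] gives determinant [r * sin t] times the squared length of
    [v]. Conversely, the angle is recovered as an arccosine from the dot product [d] and the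
    determinant [e]. *)
Lemma ccw_from_det (R : realType) (v w : R * R) :
  v.1 * w.2 - v.2 * w.1 != 0 ->
  `[< ccw_from v w >] = (0 < v.1 * w.2 - v.2 * w.1).
Proof.
case: v w => [a b] [p q] /= det0; apply/asboolP/idP => [[r [t [r0 t0pi]]]|det_gt0].
  case=> pE qE; rewrite lt_def det0 /=.
  have -> : a * q - b * p = r * sin t * (a ^+ 2 + b ^+ 2) by rewrite pE qE; ring.
  by rewrite mulr_ge0 ?addr_ge0 ?sqr_ge0 // ltW // mulr_gt0 // sin_gt0_pi.
set e := a * q - b * p in det0 det_gt0.
pose d := a * p + b * q; pose N := a ^+ 2 + b ^+ 2.
have N_gt0 : 0 < N.
  rewrite lt_def addr_ge0 ?sqr_ge0 // andbT; apply: contraNneq det0 => /eqP.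
  rewrite paddr_eq0 ?sqr_ge0 // !sqrf_eq0 /e => /andP[/eqP -> /eqP ->].
  by rewrite !mul0r subrr.
(* By Lagrange's identity [rho] is the product of the lengths of the two vectors, so [d / rho] and
   [e / rho] are the cosine and sine sought. *)
pose rho := Num.sqrt (d ^+ 2 + e ^+ 2).
have rho_gt0 : 0 < rho by rewrite sqrtr_gt0 ltr_wpDl ?sqr_ge0 ?exprn_gt0.
have rho2 : rho ^+ 2 = d ^+ 2 + e ^+ 2 by rewrite sqr_sqrtr ?addr_ge0 ?sqr_ge0.
(* Strict because [e] is positive; this keeps the angle away from 0 and pi. *)
have /andP[lt1 lt2] : - rho < d < rho.
  rewrite -ltr_norml -ltr_sqr ?nnegrE ?normr_ge0 ?(ltW rho_gt0) //.
  by rewrite -normrX ger0_norm ?sqr_ge0 // rho2 ltrDl exprn_gt0.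
have x_gt : -1 < d / rho by rewrite ltr_pdivlMr // mulN1r.
have x_lt : d / rho < 1 by rewrite ltr_pdivrMr // mul1r.
have x_itv : -1 <= d / rho <= 1 by rewrite !ltW.
have N0 : N != 0 by rewrite gt_eqF.
have rho0 : rho != 0 by rewrite gt_eqF.
(* As [N] is the squared length of the first vector, [rho / N] is the ratio of the lengths. *)
exists (rho / N), (acos (d / rho)); split.
- exact: divr_gt0.
- by rewrite acos_gt0 ?acos_ltpi // ?(ltW x_gt) ?(ltW x_lt) ?x_lt ?x_gt.
rewrite acosK // sin_acos //.
have -> : 1 - (d / rho) ^+ 2 = (e / rho) ^+ 2.
  have -> : 1 - (d / rho) ^+ 2 = (rho ^+ 2 - d ^+ 2) / rho ^+ 2 by field.
  by rewrite expr_div_n rho2 addrAC subrr add0r.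
rewrite sqrtr_sqr ger0_norm ?divr_ge0 ?ltW //=.
by congr (_, _); rewrite /e /d /N in N0 *; field; rewrite rho0 N0.
Qed.

(** The determinant is antisymmetric. For parallel nonzero directions [sgn] would be -1 in both
    orders. *)
Lemma sgn_swap (R : realType) (dir : R -> R * R) (c : R * R) :
  (dir c.1).1 * (dir c.2).2 - (dir c.1).2 * (dir c.2).1 != 0 ->
  sgn dir (swap c) = - sgn dir c.
Proof.
rewrite /sgn /=; set v := dir c.1; set w := dir c.2 => det0.
have detC : w.1 * v.2 - w.2 * v.1 = - (v.1 * w.2 - v.2 * w.1) by ring.
rewrite !ccw_from_det ?detC ?oppr_eq0 // oppr_gt0.
by case: ltgtP det0 => // _ _; rewrite opprK.
Qed.

Lemma sgn_swap_classical (R : realType) (D : twisted_knot_diagram R) c :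
  c \in classical D -> sgn (tangent D) (swap c) = - sgn (tangent D) c.
Proof.
move=> /classical_double cD; apply/sgn_swap/eqP.
by case: (genericP D) => _ /(_ c cD).
Qed.

Lemma swapK (T : Type) : involutive (@swap T).
Proof. by case. Qed.

Lemma big_mirror_classical (T : choiceType) (V : nmodType) (X : {fset T * T})
    (F : T * T -> V) :
  \sum_(c <- mirror_classical X) F c = \sum_(c <- X) F (swap c).
Proof. by rewrite big_imfset //= => c d _ _; apply: (can_inj (@swapK T)). Qed.

Lemma mirror_classicalU (T : choiceType) (X Y : {fset T * T}) :
  mirror_classical (X `|` Y) = mirror_classical X `|` mirror_classical Y.
Proof. by apply/fsetP => c; rewrite !(mem_mirror_classical, in_fsetU). Qed.

Lemma mirror_classicalD1 (T : choiceType) (X : {fset T * T}) c :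
  mirror_classical (X `\ c) = mirror_classical X `\ swap c.
Proof.
apply/fsetP => d; rewrite !(mem_mirror_classical, in_fsetD1).
by rewrite (can2_eq (@swapK T) (@swapK T)).
Qed.

Lemma alternating_union_mirror (T : choiceType)
    (A B A' B' : seq T -> {fset T * T}) s :
  (forall C, A' C = mirror_classical (A C)) ->
  (forall C, B' C = mirror_classical (B C)) ->
  alternating_union A' B' s = mirror_classical (alternating_union A B s).
Proof.
elim: s A B A' B' => [|C s IHs] A B A' B' hA hB /=.
  by apply/fsetP => c; rewrite mem_mirror_classical !in_fset0.
(* The tail alternates with the two families exchanged, hence the induction over all families. *)
by rewrite mirror_classicalU hA (IHs B A).
Qed.

(** Ensures that linking sets contain only classical crossings, where the sign reversal is
    available. *)
Lemma alternating_union_sub (T : choiceType) (A B : seq T -> {fset T * T})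
    (X : {fset T * T}) s :
  (forall C, A C `<=` X) -> (forall C, B C `<=` X) ->
  alternating_union A B s `<=` X.
Proof.
elim: s A B => [|C s IHs] A B hA hB /=; first exact: fsub0set.
by rewrite fsubUset hA IHs.
Qed.

(** The components trade places because the base points alpha and beta of a smoothing do. *)
Definition mirror_link (T : choiceType) (L : link_diagram T) :
    link_diagram T :=
  {| component1 := component2 L;
     component2 := component1 L;
     link_classical := mirror_classical (link_classical L);
     link_bars := link_bars L |}.

Section MirrorLink.
Variables (T : choiceType) (L : link_diagram T).

Lemma linking_mirror c : linking (mirror_link L) c = linking L (swap c).
Proof. by rewrite /linking /= andbC (andbC (c.1 \in _)). Qed.

Lemma over_set_mirror C :
  over_set (mirror_link L) C = mirror_classical (under_set L C).
Proof.
by apply/fsetP => c; rewrite mem_mirror_classical !inE /= mem_mirror_classical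
  linking_mirror.
Qed.

Lemma under_set_mirror C :
  under_set (mirror_link L) C = mirror_classical (over_set L C).
Proof.
by apply/fsetP => c; rewrite mem_mirror_classical !inE /= mem_mirror_classical
  linking_mirror.
Qed.

(** [arcs] depends only on the bars and the word [K], so the alternation runs over the same arcs,
    with over and under exchanged. *)
Lemma over_linking_set_mirror K :
  over_linking_set (mirror_link L) K
  = mirror_classical (under_linking_set L K).
Proof.
exact: alternating_union_mirror over_set_mirror under_set_mirror.
Qed.

Lemma under_linking_set_mirror K :
  under_linking_set (mirror_link L) K
  = mirror_classical (over_linking_set L K).
Proof.
exact: alternating_union_mirror under_set_mirror over_set_mirror.
Qed.

Lemma over_set_sub C : over_set L C `<=` link_classical L.
Proof. by apply/fsubsetP => c; rewrite !inE => /andP[]. Qed.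

Lemma under_set_sub C : under_set L C `<=` link_classical L.
Proof. by apply/fsubsetP => c; rewrite !inE => /andP[]. Qed.

Lemma over_linking_set_sub K : over_linking_set L K `<=` link_classical L.
Proof. exact: alternating_union_sub over_set_sub under_set_sub. Qed.

Lemma under_linking_set_sub K : under_linking_set L K `<=` link_classical L.
Proof. exact: alternating_union_sub under_set_sub over_set_sub. Qed.

End MirrorLink.

Lemma linking_difference_mirror (R : realType) (dir : R -> R * R)
    (L : link_diagram R) K :
  (forall c, c \in link_classical L -> sgn dir (swap c) = - sgn dir c) ->
  linking_difference dir (mirror_link L) K = linking_difference dir L K.
Proof.
move=> sgnL; have sumN (X : {fset R * R}) : X `<=` link_classical L ->
    \sum_(c <- mirror_classical X) sgn dir c = - \sum_(c <- X) sgn dir c.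
  move=> /fsubsetP XL; rewrite big_mirror_classical -sumrN.
  by apply: eq_big_seq => c /XL /sgnL.
rewrite /linking_difference over_linking_set_mirror under_linking_set_mirror.
rewrite !sumN ?over_linking_set_sub ?under_linking_set_sub //.
by rewrite opprK addrC.
Qed.

Section Mirror.
Variables (R : realType) (D : twisted_knot_diagram R).

(** Over and under parameters are exchanged, but [marks] sorts their union. *)
Lemma marks_mirror : marks (mirror D) = marks D.
Proof.
rewrite /marks /=.
have imE (f : R * R -> R) : [fset f c | c in mirror_classical (classical D)]
    = [fset f (swap c) | c in classical D].
  apply/fsetP => t; apply/imfsetP/imfsetP => /= -[c cD ->]; exists (swap c).
  - by rewrite -mem_mirror_classical.
  - by rewrite swapK.
  - by rewrite mem_mirror_classical swapK.
  - by [].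
by rewrite !imE fsetUAC.
Qed.

Lemma smoothing_mirror c :
  smoothing (mirror D) (swap c) = mirror_link (smoothing D c).
Proof.
by rewrite /smoothing /mirror_link marks_mirror /= mirror_classicalD1.
Qed.

Lemma linking_difference_smoothing_mirror c K :
  linking_difference (tangent D) (smoothing (mirror D) (swap c)) K
  = linking_difference (tangent D) (smoothing D c) K.
Proof.
rewrite smoothing_mirror linking_difference_mirror // => d.
(* Crossings that survive the smoothing are classical crossings of [D], hence transverse. *)
by rewrite in_fsetD1 => /andP[_]; apply: sgn_swap_classical.
Qed.

Lemma ind1_mirror c : ind1 (mirror D) (swap c) = ind2 D c.
Proof.
by rewrite /ind1 linking_difference_smoothing_mirror smoothing_mirror.
Qed.

Lemma ind2_mirror c : ind2 (mirror D) (swap c) = ind1 D c.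
Proof.
by rewrite /ind2 linking_difference_smoothing_mirror smoothing_mirror.
Qed.

End Mirror.

Theorem theorem3p19 (R : realType) (D : twisted_knot_diagram R) :
  B_index_polynomial (mirror D) = - B_index_polynomial D.
Proof.
rewrite /B_index_polynomial big_mirror_classical -sumrN.
apply: eq_big_seq => c cD.
(* The mirror image has the same underlying curve, so the tangents agree by conversion. *)
rewrite -[tangent (mirror D)]/(tangent D) sgn_swap_classical //.
by rewrite ind1_mirror ind2_mirror (addrC (ind2 D c)) mulrNz mulNr.
Qed.
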